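(* Let $\Gamma=E\times_{\sigma,\chi}B$ be an extension of a finite solvable group $B$ by an elementary abelian $q$-group $E$ ($q$ prime) which is a minimal normal subgroup of $\Gamma$, with monodromy $\sigma\colon B\to\mathrm{Aut}(E)$ and normalized $2$-cocycle $\chi\colon B\times B\to E$. Then $$|\mathrm{Aut}(\Gamma)|=|E|^{\zeta}\sum_{\rho\in\mathrm{Epi}(\Gamma,B)}\left(\epsilon_{\chi}(\rho)\,q^{\dim_{\mathbb{Z}_q}H^{1}_{\sigma\rho}(\Gamma,E)}-c_{\chi}\,q^{\kappa(\alpha-1)}\right),$$ where: - $\zeta=0$ if $B$ acts trivially on $E$, and $\zeta=1$ otherwise; - $\epsilon_\chi(\rho)=1$ if the equation $\delta^1 f=-\rho^*\chi$ has a solution $f\colon \Gamma\to E$, and $\epsilon_\chi(\rho)=0$ otherwise; - $c_\chi=1$ if $[\chi]=0$ in $H^2_\sigma(B,E)$, and $c_\chi=0$ otherwise; - $\alpha$ is the number of complemented chief factors of $\Gamma$ isomorphic to $E$ as $\Gamma$-modules (under the conjugation action); - $\kappa$ is defined by $q^{\kappa}=|\mathrm{End}_{\Gamma}(E)|$.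
   Context: $\mathrm{Epi}(\Gamma,B)$ denotes the set of surjective homomorphisms $\Gamma\to B$, and $\mathbb{Z}_q=\mathbb{Z}/q\mathbb{Z}$. Abelian groups are written additively. For an extension $1\to A\xrightarrow{i}\Gamma\xrightarrow{\pi} B\to1$ with $A$ abelian and a set section $s\colon B\to\Gamma$ of $\pi$ with $s(1)=1$, the monodromy $\sigma\colon B\to\mathrm{Aut}(A)$ is defined by $i(\sigma_b(a))=s(b)i(a)s(b)^{-1}$, and the $2$-cocycle $\chi$ by $i(\chi(b,b'))=s(b)s(b')s(bb')^{-1}$; such an extension is written $\Gamma=A\times_{\sigma,\chi}B$. For a homomorphism $\rho\colon G\to B$ (here $G=\Gamma$), $A$ is a $G$-module via $\sigma\rho$, and $H^1_{\sigma\rho}(G,A)$ is group cohomology with these coefficients. For $f\colon G\to A$, $(\delta^1 f)(g,h)=\sigma_{\rho(g)}(f(h))-f(gh)+f(g)$, and $(\rho^*\chi)(g,h)=\chi(\rho(g),\rho(h))$. The chief factors of $\Gamma$ are the quotients $H/K$ of consecutive terms of a chief series of $\Gamma$ (a maximal chain of normal subgroups of $\Gamma$), counted with multiplicity. A chief factor $H/K$ is complemented if it has a complement in $\Gamma/K$. $\mathrm{End}_\Gamma(E)$ is the ring of $\Gamma$-module endomorphisms of $E$. *)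

(* Defs.v *)
From HB Require Import structures.
From mathcomp Require Import all_boot all_order all_algebra all_fingroup all_solvable.

Set Implicit Arguments.
Unset Strict Implicit.
Unset Printing Implicit Defensive.

Import Order.TTheory GRing.Theory Num.Theory.

(* A finZmodType is also a finGroupType, whose group law is its addition; this
   makes pointwise addition the group law of the finite group {ffun aT -> E}. *)
HB.instance Definition _ (aT : finType) (E : finZmodType) :=
  Finite.on {ffun aT -> E}.

(* 0 -> E -> Gamma -> B -> 1 with Gamma = [set: gT] and B = [set: bT], a
   normalized section s, its monodromy sigma and its 2-cocycle chi. *)
Record extension (gT bT : finGroupType) (E : finZmodType)
    (i : {morphism [set: E] >-> gT}) (pi : {morphism [set: gT] >-> bT})
    (s : bT -> gT) (sigma : bT -> {perm E}) (chi : {ffun bT * bT -> E}) :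
    Prop := Extension {
  ext_inj : ('injm i)%g;
  ext_surj : (pi @* [set: gT])%g = [set: bT];
  ext_exact : (i @* [set: E])%g = ('ker pi)%g;
  ext_section : cancel s pi;
  ext_section1 : s 1%g = 1%g;
  ext_Aut : forall b, sigma b \in Aut [set: E];
  ext_sigma : forall b a, i (sigma b a) = (s b * i a * (s b)^-1)%g;
  ext_chi : forall b b', i (chi (b, b')) = (s b * s b' * (s (b * b'))^-1)%g
}.

Definition Epi (gT bT : finGroupType) : {set {ffun gT -> bT}} :=
  [set rho : {ffun gT -> bT} | morphic [set: gT] rho
     & rho @: [set: gT] == [set: bT]].

Section Cohomology.

Variables (gT : finGroupType) (E : finZmodType).
(* tau g a is the action of g on a: all of gT acts on E, on the left. *)
Variable tau : gT -> E -> E.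

Definition delta0 (a : E) : {ffun gT -> E} := [ffun g => (tau g a - a)%R].

Definition delta1 (f : {ffun gT -> E}) : {ffun gT * gT -> E} :=
  [ffun gh => (tau gh.1 (f gh.2) - f (gh.1 * gh.2)%g + f gh.1)%R].

Definition cocycles1 : {set {ffun gT -> E}} := [set f | delta1 f == 0%R].
Definition coboundaries1 : {set {ffun gT -> E}} := [set delta0 a | a : E].
Definition H1 : {set coset_of coboundaries1} := (cocycles1 / coboundaries1)%g.

Definition coboundaries2 : {set {ffun gT * gT -> E}} :=
  [set delta1 f | f : {ffun gT -> E}].

Definition gmod_End : {set {ffun E -> E}} :=
  [set f : {ffun E -> E} | morphic [set: E] f
     & [forall g, forall a, f (tau g a) == tau g (f a)]].

(* The left action of g on H / K is v |-> g v g^-1, and x ^ y is y^-1 x y. *)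
Definition gmod_isog (H K : {group gT}) : bool :=
  [exists f : {ffun E -> coset_of K}, misom [set: E] (H / K)%g f
     && [forall g, forall a, f (tau g a) == (f a ^ (coset K g)^-1)%g]].

(* cs lists the nontrivial terms of a series that starts at 1; the pair
   KH = (K, H) of consecutive terms stands for the factor H / K. *)
Definition complemented_count (cs : seq {group gT}) : nat :=
  count (fun KH : {group gT} * {group gT} =>
           [splits [set: gT] / KH.1, over KH.2 / KH.1]%g
             && gmod_isog KH.2 KH.1)
        (zip (1%G :: cs) cs).

End Cohomology.

Definition chief_series (gT : finGroupType) (cs : seq {group gT}) : bool :=
  (([set: gT].-chief).-series 1%G cs)%g && (last 1%G cs == [set: gT]%G).

(* An elementary abelian q-group is a Z_q-vector space whose subspaces are its
   subgroups, so its dimension is the least size of a generating set. *)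
Definition Zq_dim (aT : finGroupType) (V : {set aT}) : nat := 'm(V)%g.

Section Invariants.

Variables (gT bT : finGroupType) (E : finZmodType).
Variables (pi : gT -> bT) (sigma : bT -> {perm E}) (chi : {ffun bT * bT -> E}).

(* The module structure that a map rho : Gamma -> B induces on E; for rho = pi
   it is conjugation in Gamma, see ext_conj. *)
Definition pullback_act (rho : gT -> bT) (g : gT) (a : E) : E := sigma (rho g) a.

Definition pullback_cocycle (rho : gT -> bT) : {ffun gT * gT -> E} :=
  [ffun gh => chi (rho gh.1, rho gh.2)].

Definition zeta : nat := ~~ [forall b, forall a, sigma b a == a].

Definition epsilon (rho : gT -> bT) : nat :=
  [exists f : {ffun gT -> E},
     delta1 (pullback_act rho) f == (- pullback_cocycle rho)%R].

(* chi is a 2-cocycle by ext_chi, so its class in H^2 = Z^2 / B^2 is defined; it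
   is 0 when chi is in B^2. *)
Definition c_chi : nat := chi \in coboundaries2 (fun b a => sigma b a).

Definition alpha (cs : seq {group gT}) : nat :=
  complemented_count (pullback_act pi) cs.

End Invariants.

Lemma ext_conj (gT bT : finGroupType) (E : finZmodType)
    (i : {morphism [set: E] >-> gT}) (pi : {morphism [set: gT] >-> bT})
    (s : bT -> gT) (sigma : bT -> {perm E}) (chi : {ffun bT * bT -> E}) :
  extension i pi s sigma chi ->
  forall g a, i (pullback_act sigma pi g a) = (g * i a * g^-1)%g.
Proof.
move=> [_ _ ker_pi sK _ _ iS _] g a; rewrite /pullback_act iS.
have: (g * (s (pi g))^-1)%g \in ('ker pi)%g.
  apply/kerP; first by rewrite inE.
  by rewrite morphM ?morphV ?inE // sK mulgV.
rewrite -ker_pi => /morphimP[e _ _ /(canRL (mulgKV _)) {3 4}->].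
rewrite invMg !mulgA.
suff -> : (i e * s (pi g) * i a * (s (pi g))^-1
           = s (pi g) * i a * (s (pi g))^-1 * i e)%g by rewrite mulgK.
rewrite -iS -(mulgA (i e)) -(mulgA (i e)) -iS -!morphM ?inE //.
by congr (i _); apply: addrC.
Qed.

Section CohomologyFacts.

Variables (gT : finGroupType) (E : finZmodType) (tau : gT -> E -> E).
Hypothesis tauD : forall g, {morph tau g : a b / (a + b)%R}.
Hypothesis tauM : forall g h a, tau (g * h)%g a = tau g (tau h a).

Lemma cocycles1_group_set : group_set (cocycles1 tau).
Proof.
have tau0 g : tau g 0%R = 0%R.
  by apply: (addrI (tau g 0%R)); rewrite -tauD !addr0.
apply/group_setP; split=> [|f f'].
  by rewrite inE; apply/eqP/ffunP=> gh; rewrite !ffunE tau0 subr0 addr0.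
rewrite !inE => /eqP/ffunP Zf /eqP/ffunP Zf'; apply/eqP/ffunP=> gh.
have := congr2 +%R (Zf gh) (Zf' gh); rewrite !ffunE addr0 => <-.
by rewrite tauD opprD [RHS]addrACA; congr (_ + _)%R; apply: addrACA.
Qed.

Lemma coboundaries1_group_set : group_set (coboundaries1 tau).
Proof.
apply/group_setP; split=> [|f f' /imsetP[a _ ->] /imsetP[b _ ->]].
  apply/imsetP; exists 0%R => //; apply/ffunP=> g; rewrite !ffunE subr0.
  by apply: (addrI (tau g 0%R)); rewrite -tauD !addr0.
apply/imsetP; exists (a + b)%R => //; apply/ffunP=> g; rewrite !ffunE tauD.
by rewrite opprD addrACA.
Qed.

Lemma sub_coboundaries1 : coboundaries1 tau \subset cocycles1 tau.
Proof.
apply/subsetP=> _ /imsetP[a _ ->]; rewrite inE; apply/eqP/ffunP=> gh.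
rewrite !ffunE tauM.
have -> : tau gh.1 (tau gh.2 a - a)%R
          = (tau gh.1 (tau gh.2 a) - tau gh.1 a)%R.
  by apply: (addIr (tau gh.1 a)); rewrite -tauD !subrK.
by rewrite opprB [X in (X + _)%R]addrC !addrA !subrK subrr.
Qed.

Lemma H1_abelem (q : nat) : prime q ->
  (q.-abelem [set: E])%g -> (q.-abelem (H1 tau))%g.
Proof.
move=> q_pr /(abelemP q_pr)[_ Eq].
apply: (@quotient_abelem _ q (Group cocycles1_group_set)
                             (Group coboundaries1_group_set)).
apply/(abelemP q_pr); split=> [|f _].
  exact: FinRing.zmod_abelian.
rewrite FinRing.zmodXgE; apply/ffunP=> g; rewrite ffunMnE.
by rewrite -FinRing.zmodXgE Eq ?inE // ffunE.
Qed.

End CohomologyFacts.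

Lemma Zq_dimP (q : nat) (aT : finGroupType) (V : {group aT}) :
  prime q -> (q.-abelem V)%g -> (V \isog [set: 'rV['F_q]_(Zq_dim V)])%g.
Proof.
move=> q_pr abV; have pV := abelem_pgroup abV.
have dimV : #|V| = (q ^ Zq_dim V)%N.
  rewrite /Zq_dim (grank_abelian (abelem_abelian abV)) (rank_abelem abV).
  by rewrite -(card_pgroup pV).
have abR : (q.-abelem [set: 'rV['F_q]_(Zq_dim V)])%g.
  apply/(abelemP q_pr); split=> [|x _]; first exact: FinRing.zmod_abelian.
  by rewrite FinRing.zmodXgE -scaler_nat pchar_Fp_0 ?scale0r.
rewrite (isog_abelem_card _ abV) abR cardsT card_mx card_Fp // mul1n dimV.
exact: eqxx.
Qed.

(* Main.v *)
Require Import Defs.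
From mathcomp Require Import all_boot all_order all_algebra all_fingroup.
From mathcomp Require Import all_solvable.

Set Implicit Arguments.
Unset Strict Implicit.
Unset Printing Implicit Defensive.

Import Order.TTheory GRing.Theory Num.Theory.

Local Open Scope ring_scope.

(** An endomorphism phi of Gamma with pi phi = rho surjective can be written
    phi g = i (f g) s (rho g), and it is multiplicative exactly when delta1 f =
    - rho^* chi. So the lifts of rho, if there are any, form a torsor under
    Z^1(Gamma, E), where Gamma acts through rho; as E is simple, B^1 has order
    |E|^zeta, which makes |E|^zeta q^(dim H^1) lifts ([card_lifts],
    [card_cocycles1_H1], [card_coboundaries1]).

    A lift is an automorphism unless it is non-injective, and every
    automorphism u is a lift of the single epimorphism pi u ([card_Aut_lifts]).
    The elements of E reached by a lift form a submodule: if it is E, the lift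
    is onto, and otherwise the image meets E trivially and the lift factors
    through rho. Hence the non-injective lifts of rho correspond to the
    homomorphic sections of pi, whatever rho is ([card_noninjective_lifts]).
    There is none unless chi is a coboundary, and then there are |Z^1(B, E)| of
    them ([card_lifts_id]).

    It remains to see that |Z^1(B, E)| = |E|^zeta q^(kappa (alpha - 1)) when
    the extension splits. This is a theorem of Gaschuetz: for a solvable group
    G and a simple module E, |Z^1(G, E)| = |End_G(E)|^alpha |E|^zeta
    ([card_cocycles1_chief]). To prove it, let F(K) be the set of cocycles that
    vanish on K, and let K run through a chief series of G. For a chief factor
    H / K with H acting trivially on E, restriction to H maps F(K) to Hom_G(H /
    K, E) with kernel F(H); its image is 0 or everything, and a cocycle with
    nonzero restriction is the same thing as an isomorphism H / K ~ E together
    with a complement of H / K in G / K. If K acts trivially and H does not,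
    then H / K has order prime to q, so averaging over it shows that F(K)
    consists of coboundaries: this step happens once if G acts nontrivially and
    accounts for |E|^zeta. If K acts nontrivially then F(K) = 0.

    Restriction to i E, whose image is all of End_Gamma(E) in a split extension
    and whose kernel is Z^1(B, E), gives |Z^1(Gamma, E)| = |Z^1(B, E)|
    |End_Gamma(E)| ([card_cocycles1_split]); this is where the exponent alpha -
    1 comes from. *)

(** * Cocycles vanishing on a subgroup *)

Lemma normal_conj (gT : finGroupType) (H : {group gT}) g h :
  (H <| [set: gT])%g -> h \in H -> (g * h * g^-1)%g \in H.
Proof.
move=> nsHG Hh; have -> : (g * h * g^-1 = h ^ g^-1)%g.
  by rewrite conjgE invgK mulgA.
by rewrite memJ_norm // groupV (subsetP (normal_norm nsHG)) ?inE.
Qed.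

Section Cocycles.

Variables (gT : finGroupType) (E : finZmodType) (tau : gT -> E -> E).
Hypothesis tauD : forall g, {morph tau g : a b / a + b}.
Hypothesis tauM : forall g h a, tau (g * h)%g a = tau g (tau h a).
Hypothesis tau1 : forall a, tau 1%g a = a.

Lemma act0 g : tau g 0 = 0.
Proof. by apply: (addrI (tau g 0)); rewrite -tauD !addr0. Qed.

Lemma actN g a : tau g (- a) = - tau g a.
Proof. by apply: (addrI (tau g a)); rewrite -tauD !subrr act0. Qed.

Lemma actB g a b : tau g (a - b) = tau g a - tau g b.
Proof. by rewrite tauD actN. Qed.

Lemma actKV g : cancel (tau g^-1%g) (tau g).
Proof. by move=> a; rewrite -tauM mulgV tau1. Qed.

Lemma delta1D : {morph delta1 tau : f f' / f + f'}.
Proof.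
move=> f f'; apply/ffunP=> gh; rewrite !ffunE tauD opprD.
by rewrite (addrACA (tau _ _)) (addrACA (tau _ _ - _)).
Qed.

Lemma delta1N f : delta1 tau (- f) = - delta1 tau f.
Proof. by apply/ffunP=> gh; rewrite !ffunE actN !opprD. Qed.

Lemma cocycle1P (f : {ffun gT -> E}) :
  reflect (forall g h, f (g * h)%g = f g + tau g (f h)) (f \in cocycles1 tau).
Proof.
have E0 (x y z : E) : (x - y + z == 0) = (y == z + x).
  by rewrite addrAC subr_eq0 eq_sym addrC.
rewrite inE; apply: (iffP eqP) => [/ffunP Zf g h | Zf].
  by have := Zf (g, h); rewrite !ffunE /= => /eqP; rewrite E0 => /eqP.
by apply/ffunP=> -[g h]; rewrite !ffunE /=; apply/eqP; rewrite E0 Zf.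
Qed.

Lemma cocycle1_at1 f : f \in cocycles1 tau -> f 1%g = 0.
Proof.
move/cocycle1P=> Zf; apply: (addrI (f 1%g)).
by rewrite -{2}[f 1%g]tau1 -Zf mulg1 addr0.
Qed.

Lemma cocycle1B f f' :
  f \in cocycles1 tau -> f' \in cocycles1 tau -> f - f' \in cocycles1 tau.
Proof.
move=> /cocycle1P Zf /cocycle1P Zf'; apply/cocycle1P=> g h.
by rewrite !ffunE Zf Zf' actB opprD addrACA.
Qed.

Definition vanishing_cocycles (K : {set gT}) :=
  [set f in cocycles1 tau | [forall h in K, f h == 0]].

Lemma vanishingP (K : {set gT}) (f : {ffun gT -> E}) :
  reflect (f \in cocycles1 tau /\ {in K, forall h, f h = 0})
          (f \in vanishing_cocycles K).
Proof.
rewrite !inE; apply: (iffP andP) => -[Zf fK]; split=> //.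
  by move=> h Kh; apply/eqP; apply: (forall_inP fK).
by apply/forall_inP=> h Kh; apply/eqP/fK.
Qed.

Lemma vanishing_at1 : vanishing_cocycles 1%g = cocycles1 tau.
Proof.
apply/setP=> f; apply/vanishingP/idP=> [[] | Zf] //.
by split=> // _ /set1P->; apply: cocycle1_at1.
Qed.

Lemma gmod_EndP (u : {ffun E -> E}) :
  reflect ({morph u : a b / a + b} /\ forall g a, u (tau g a) = tau g (u a))
          (u \in gmod_End tau).
Proof.
rewrite inE; apply: (iffP andP) => -[uD uG]; split.
- by move=> a b; apply: (morphicP uD); rewrite inE.
- by move=> g a; apply/eqP; move/forallP: uG => /(_ g)/forallP/(_ a).
- by apply/morphicP=> a b _ _; apply: uD.
by apply/forallP=> g; apply/forallP=> a; rewrite uG.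
Qed.

Definition acts_trivially (K : {set gT}) :=
  [forall h in K, forall a, tau h a == a].

Lemma acts_triviallyP (K : {set gT}) :
  reflect {in K, forall h a, tau h a = a} (acts_trivially K).
Proof.
apply: (iffP forall_inP) => [trK h Kh a | trK h Kh].
  by apply/eqP; move: a; apply/forallP; apply: trK.
by apply/forallP=> a; rewrite trK.
Qed.

(** This is why restricting a cocycle to a normal subgroup that acts trivially
    gives a module homomorphism, and not just a group homomorphism. *)
Lemma cocycle1_conj (H : {group gT}) (f : {ffun gT -> E}) g h :
    (H <| [set: gT])%g -> acts_trivially H -> f \in cocycles1 tau -> h \in H ->
  f (g * h * g^-1)%g = tau g (f h).
Proof.
move=> nsHG /acts_triviallyP trH /cocycle1P Zf Hh.
apply: (addIr (f g)); have:= Zf (g * h * g^-1)%g g.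
by rewrite trH ?normal_conj // => <-; rewrite mulgKV Zf addrC.
Qed.

(** When [H] acts trivially, the restriction of such a cocycle to [H] induces an
    isomorphism of [H / K] with [E], and its zero set is a complement of [H]
    modulo [K]. *)
Definition splitting_cocycle (K H : {set gT}) (f : {ffun gT -> E}) :=
  [/\ f \in vanishing_cocycles K, {in H, forall h, f h = 0 -> h \in K}
    & forall a, exists2 h, h \in H & f h = a].

(** The restrictions to [H] of cocycles vanishing on [K] are module
    homomorphisms from [H / K] to [E]. Since [f0] identifies [H / K] with [E],
    they are the [u \o f0] with [u] an endomorphism of [E]; each of them
    extends to the cocycle [u \o f0] of the whole group, so a cocycle vanishing
    on [K] is uniquely [f1 + u \o f0] with [f1] vanishing on [H]. *)
Lemma card_vanishing_splitting (K H : {group gT}) (f0 : {ffun gT -> E}) :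
    (H <| [set: gT])%g -> K \subset H -> acts_trivially H ->
    splitting_cocycle K H f0 ->
  #|vanishing_cocycles K|
    = (#|vanishing_cocycles H| * #|gmod_End tau|)%N.
Proof.
move=> nsHG sKH trivH [/vanishingP[Zf0_ f0K] kerf0 f0H].
have [Zf0 trH] := (cocycle1P _ Zf0_, acts_triviallyP _ trivH).
pose sec a := odflt 1%g [pick h in H | f0 h == a].
have secP a : sec a \in H /\ f0 (sec a) = a.
  rewrite /sec; case: pickP => [h /andP[Hh /eqP]|] //= nosec.
  by have [h Hh f0h] := f0H a; have:= nosec h; rewrite Hh f0h eqxx.
pose F (p : {ffun gT -> E} * {ffun E -> E}) := p.1 + [ffun g => p.2 (f0 g)].
rewrite -cardsX -(card_in_imset (f := F)) => [|[f1 u] [f2 v]]; last first.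
  move=> /setXP[/= /vanishingP[_ f1H] _] /setXP[/= /vanishingP[_ f2H] _].
  move=> /ffunP eqF; suff eq_uv: u = v.
    congr (_, _) => //; apply/ffunP=> g; move: (eqF g); rewrite !ffunE /= eq_uv.
    exact: addIr.
  apply/ffunP=> a; have [Hh f0h] := secP a; move: (eqF (sec a)).
  by rewrite !ffunE /= f1H // f2H // f0h !add0r.
congr #|pred_of_set _|; apply/setP=> f; apply/idP/imsetP; last first.
  case=> -[f1 u] /setXP[/= /vanishingP[/cocycle1P Zf1 f1H]].
  case/gmod_EndP=> uD uG ->; apply/vanishingP; split.
    by apply/cocycle1P=> g h; rewrite !ffunE /= Zf1 Zf0 uD uG tauD addrACA.
  move=> h Kh; rewrite !ffunE /= f1H ?(subsetP sKH) // f0K // add0r.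
  by apply: (addrI (u 0)); rewrite -uD !addr0.
case/vanishingP=> Zf_ fK; have Zf := cocycle1P _ Zf_.
have f_add h h' : h \in H -> f (h * h')%g = f h + f h'.
  by move=> Hh; rewrite Zf trH.
have f0_add h h' : h \in H -> f0 (h * h')%g = f0 h + f0 h'.
  by move=> Hh; rewrite Zf0 trH.
have f_f0 h h' : h \in H -> h' \in H -> f0 h = f0 h' -> f h = f h'.
  move=> Hh Hh' eqf0; rewrite -{1}(mulgKV h' h) f_add ?groupM ?groupV //.
  rewrite [f (h * _)%g]fK ?add0r // kerf0 ?groupM ?groupV //.
  by apply: (addIr (f0 h')); rewrite -f0_add ?groupM ?groupV // mulgKV add0r.
pose u := [ffun a => f (sec a)].
have u_f0 h : h \in H -> u (f0 h) = f h.
  by move=> Hh; have [Hs f0s] := secP (f0 h); rewrite ffunE; apply: f_f0.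
have uE : u \in gmod_End tau.
  apply/gmod_EndP; split=> [a b | g a].
    have [[Ha <-] [Hb <-]] := (secP a, secP b).
    by rewrite -f0_add // !u_f0 ?groupM // f_add.
  have [Ha <-] := secP a.
  rewrite -(cocycle1_conj g nsHG trivH Zf0_ Ha) !u_f0 ?normal_conj //.
  exact: (cocycle1_conj _ nsHG).
have [uD uG] := gmod_EndP _ uE; clearbody u.
exists (f - [ffun g => u (f0 g)], u); last first.
  by apply/ffunP=> g; rewrite !ffunE /= subrK.
apply/setXP; split=> //=; apply/vanishingP; split.
  apply: cocycle1B => //.
  by apply/cocycle1P=> g h; rewrite !ffunE Zf0 uD uG.
by move=> h Hh; rewrite !ffunE u_f0 // subrr.
Qed.

Lemma card_delta1_fiber (d : {ffun gT * gT -> E}) :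
  #|[set f | delta1 tau f == d]|
    = ([exists f, delta1 tau f == d] * #|cocycles1 tau|)%N.
Proof.
case: (boolP [exists f, _]) => [/existsP[f0 /eqP f0d] | no_f]; last first.
  apply/eqP; rewrite mul0n cards_eq0; apply/eqP/setP=> f; rewrite !inE.
  by apply: contraNF no_f => fd; apply/existsP; exists f.
rewrite mul1n -(card_imset (cocycles1 tau) (addIr f0)).
congr #|pred_of_set _|; apply/setP=> f; rewrite inE; apply/idP/imsetP.
  move/eqP=> fd; exists (f - f0); rewrite ?subrK // inE; apply/eqP.
  by apply: (addIr (delta1 tau f0)); rewrite -delta1D subrK add0r fd.
by case=> f'; rewrite inE => /eqP f'0 ->; rewrite delta1D f'0 add0r f0d.
Qed.

(** * Cocycles with values in a simple module *)

Definition gmod_simple := forall V : {group E},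
  (forall g a, a \in V -> tau g a \in V) -> V :=: 1%g \/ V :=: [set: E].

Hypothesis tau_simple : gmod_simple.

(** The elements fixed by a normal subgroup form a submodule. *)
Lemma fixed_by_normal (K : {group gT}) a :
    (K <| [set: gT])%g -> ~~ acts_trivially K ->
  {in K, forall h, tau h a = a} -> a = 0.
Proof.
move=> /andP[_ nKG] ntrK Ka.
pose V := [set b | [forall h in K, tau h b == b]].
have VP b : reflect {in K, forall h, tau h b = b} (b \in V).
  rewrite inE; apply: (iffP forall_inP) => bV h Kh; first exact/eqP/bV.
  by rewrite bV.
have gV : group_set V.
  apply/group_setP; split=> [|b c /VP Vb /VP Vc]; apply/VP=> h Kh.
    exact: act0.
  by rewrite tauD Vb ?Vc.
have [|V1|VE] := @tau_simple (Group gV).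
- move=> g b /VP Vb; apply/VP=> h Kh.
  rewrite -tauM (conjgC h g) tauM Vb //.
  by rewrite memJ_norm // (subsetP nKG) ?inE.
- have: a \in V by apply/VP.
  by rewrite [V]V1 => /set1P.
case/acts_triviallyP: ntrK => h Kh b; apply: (VP b) => //.
by rewrite [V]VE inE.
Qed.

Lemma coboundary_cocycle a : delta0 tau a \in cocycles1 tau.
Proof. exact/(subsetP (sub_coboundaries1 tauD tauM))/imset_f. Qed.

(** The kernel of [delta0] is the submodule of elements fixed by the whole
    group. *)
Lemma card_coboundaries1 :
  #|coboundaries1 tau| = (#|E| ^ ~~ acts_trivially [set: gT])%N.
Proof.
case: (boolP (acts_trivially _)) => [/acts_triviallyP trG | ntrG] /=.
  rewrite expn0 (_ : coboundaries1 tau = [set 0]) ?cards1 //.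
  apply/setP=> f; rewrite inE; apply/imsetP/eqP => [[a _ ->] | ->].
    by apply/ffunP=> g; rewrite !ffunE trG ?inE // subrr.
  by exists 0 => //; apply/ffunP=> g; rewrite !ffunE trG ?inE // subrr.
rewrite expn1 card_imset // => a b /ffunP eq_ab; apply/eqP.
rewrite -subr_eq0; apply/eqP/(fixed_by_normal (K := [set: gT]%G)) => //.
move=> g _; have:= eq_ab g; rewrite !ffunE actB => /(canRL (subrK _)) ->.
by rewrite addrC !addrA addNr add0r addrC.
Qed.

(** A cocycle that vanishes on [K] satisfies [f g = f (h g) = tau h (f g)] for
    [h] in [K], because [h g] and [g] are in the same left coset of [K]: its
    values are fixed by [K]. *)
Lemma vanishing_nontrivial (K : {group gT}) :
    (K <| [set: gT])%g -> ~~ acts_trivially K ->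
  vanishing_cocycles K = [set 0].
Proof.
move=> nsKG ntrK; apply/setP=> f; rewrite [RHS]inE.
apply/vanishingP/eqP; last first.
  move=> ->; split=> [|h _]; last by rewrite ffunE.
  by apply/cocycle1P=> g h; rewrite !ffunE act0 addr0.
case=> /cocycle1P Zf fK; apply/ffunP=> g; rewrite ffunE.
apply: (fixed_by_normal nsKG ntrK) => h Kh.
have:= Zf h g; rewrite (fK h) // add0r => <-.
have nKG := normal_norm nsKG.
rewrite (conjgC h) Zf (fK (h ^ g)%g) ?act0 ?addr0 //.
by rewrite memJ_norm // (subsetP nKG) ?inE.
Qed.

(** Averaging: summing [f (h x) = f h + tau h (f x)] over [x] in [H / K] gives
    [n f h = a - tau h a], where [a] is the sum of the [f x] and [n], the order
    of [H / K], is invertible modulo the order of [E]. *)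
Lemma coprime_cocycle_coboundary (K H : {group gT}) f :
    (K <| [set: gT])%g -> acts_trivially K ->
    coprime #|[set: E]| #|(H / K)%g| -> f \in vanishing_cocycles K ->
  exists a, {in H, f =1 delta0 tau a}.
Proof.
move=> /andP[_ nKG] /acts_triviallyP trK co_EHK /vanishingP[/cocycle1P Zf fK].
have inN g : g \in 'N(K)%g by rewrite (subsetP nKG) ?inE.
pose fbar (x : coset_of K) := f (repr x).
have fKE g : fbar (coset K g) = f g.
  have /rcosetP[k Kk def_r] : repr (coset K g) \in (K :* g)%g.
    by rewrite -val_coset ?mem_repr_coset.
  by rewrite /fbar def_r Zf fK // add0r trK.
pose n := #|(H / K)%g|; pose a := \sum_(x in (H / K)%g) fbar x.
pose m := expg_invn [set: E] n.
have nmK (b : E) : b *+ n *+ m = b.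
  by rewrite -!FinRing.zmodXgE expgK ?inE.
exists (- (a *+ m)) => h Hh.
have sumE : a = f h *+ n + tau h a.
  have HKh : coset K h \in (H / K)%g by apply: mem_quotient.
  rewrite {1}/a (reindex_inj (mulgI (coset K h))) /=.
  rewrite (eq_bigl (mem (H / K)%g)) => [|x]; last by rewrite /= groupMl.
  rewrite (eq_bigr (fun x => f h + tau h (fbar x))) => [|x _]; last first.
    by rewrite -(coset_reprK x) -morphM ?inN // !fKE Zf.
  rewrite big_split sumr_const; congr (_ + _).
  by rewrite (big_morph (tau h) (tauD h) (act0 h)).
rewrite -[LHS]nmK ffunE actN opprK addrC.
have -> : f h *+ n = a - tau h a by rewrite {1}sumE addrK.
have -> : tau h (a *+ m) = tau h a *+ m.
  by elim: m {nmK} => [|m IHm]; rewrite ?mulr0n ?act0 // !mulrS tauD IHm.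
by rewrite mulrnBl.
Qed.

(** A [q]-group acting on a nontrivial [q]-group has nontrivial fixed points;
    as [H] is normal they form a submodule, hence all of [E]. *)
Lemma pgroup_acts_trivially (q : nat) (K H : {group gT}) :
    [set: E] != 1%g -> prime q -> (q.-group [set: E])%g ->
    (K <| [set: gT])%g -> (H <| [set: gT])%g -> acts_trivially K ->
    (q.-group (H / K))%g ->
  acts_trivially H.
Proof.
move=> ntE q_pr qE nsKG nsHG /acts_triviallyP trK qHK; apply/negPn/negP=> ntrH.
(* Permutations compose from left to right, so g has to act by tau g^-1. *)
pose P g : {perm E} := perm (can_inj (actKV g)).
have PM : {in [set: gT] &, {morph P : g h / (g * h)%g}}.
  by move=> g h _ _; apply/permP=> a; rewrite permM !permE invMg tauM.
pose PP := Morphism PM.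
have qP : (q.-group (PP @* H))%g.
  have PK : (PP @* K = 1)%g.
    apply/trivgP/subsetP=> _ /morphimP[k _ Kk ->]; rewrite inE /=.
    by apply/eqP/permP=> a; rewrite permE perm1 trK ?groupV.
  rewrite /pgroup -[#|_|](indexg1 (PP @* H)%G) /= -PK.
  apply: pnat_dvd (index_morphim _ _) _; first exact: subsetT.
  have /andP[_ nKG] := nsKG.
  by rewrite -card_quotient // (subset_trans (subsetT H)).
have actsP : ([acts PP @* H, on [set: E] | 'P])%g.
  by apply/actsP=> x _ a; rewrite !inE.
(* The number of fixed points is a multiple of q; if H acted nontrivially, 0
   would be the only fixed point. *)
have := pgroup_fix_mod qP actsP.
have [n cardE] := p_natP qE.
have n_gt0 : (0 < n)%N.
  by case: n cardE => // /eqP; rewrite expn0 -trivg_card1 (negPf ntE).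
rewrite cardE -(prednK n_gt0) expnS modnMr.
suff ->: ('Fix_([set: E] | 'P)(PP @* H))%g = [set 0].
  by rewrite cards1 modn_small ?prime_gt1.
apply/setP=> a; rewrite in_setI in_setT in_set1; apply/afixP/eqP=> [fixa | ->].
  apply: (fixed_by_normal nsHG ntrH) => h Hh.
  have := fixa (PP h^-1)%g; rewrite mem_morphim ?inE ?groupV // => /(_ isT).
  by rewrite /= /aperm permE invgK.
by move=> _ /morphimP[h _ Hh ->]; rewrite /= /aperm permE act0.
Qed.

(** * Complements of chief factors *)

Lemma vanishing_coset (K : {group gT}) (f : {ffun gT -> E}) g h :
    (K <| [set: gT])%g -> acts_trivially K -> f \in vanishing_cocycles K ->
  coset K g = coset K h -> f g = f h.
Proof.
move=> /andP[_ nKG] /acts_triviallyP trK /vanishingP[/cocycle1P Zf fK].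
have inN x : x \in 'N(K)%g by rewrite (subsetP nKG) ?inE.
case/(rcoset_kercosetP (inN g) (inN h))/rcosetP=> k Kk ->.
by rewrite Zf fK // add0r trK.
Qed.

Lemma misomE (rT : finGroupType) (B : {group rT}) (u : E -> rT) :
  reflect [/\ {morph u : a b / a + b >-> (a * b)%g}, injective u
            & forall x, (x \in B) = [exists a, x == u a]]
          (misom [set: E] B u).
Proof.
apply: (iffP idP) => [/misomP[uM /isomP[injU imU]] | [uM uI imU]].
  split=> [a b | a b eq_u | x].
  - by apply: (morphicP uM); rewrite inE.
  - by apply: (injmP injU); rewrite ?inE //.
  rewrite -imU; apply/morphimP/existsP => [[a _ _ ->] | [a /eqP->]].
    by exists a.
  by exists a; rewrite ?inE.
have uM' : morphic [set: E] u by apply/morphicP=> a b _ _; apply: uM.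
apply/misomP; exists uM'; apply/isomP; split.
  by apply/injmP=> a b _ _; apply: uI.
apply/setP=> x; rewrite imU.
by apply/morphimP/existsP => [[a _ _ ->]|[a /eqP->]]; exists a; rewrite ?inE.
Qed.

(** If [C] is a complement and [u] an isomorphism from [E] to [H / K], the
    cocycle is the [H / K]-component of [g], read through [u]: [f g] is the [a]
    for which [coset K g] lies in [u a * C]. *)
Lemma splitting_of_complement (K H : {group gT}) :
    (K <| [set: gT])%g ->
    [splits [set: gT] / K, over H / K]%g -> gmod_isog tau H K ->
  exists f, splitting_cocycle K H f.
Proof.
move=> /andP[_ nKG] /splitsP[C /complP[tiHC prodHC]].
case/existsP=> u /andP[/misomE[uD uI imu] uG].
have {}uG g a : u (tau g a) = (u a ^ (coset K g)^-1)%g.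
  by apply/eqP; move/forallP: uG => /(_ g)/forallP/(_ a).
have inN x : x \in 'N(K)%g by rewrite (subsetP nKG) ?inE.
pose Q g a := ((u a)^-1 * coset K g)%g \in C.
have uH a : u a \in (H / K)%g by rewrite imu; apply/existsP; exists a.
have Q_uniq g a b : Q g a -> Q g b -> a = b.
  move=> Ca Cb; apply: uI; apply/eqP; rewrite eq_mulVg1.
  have: ((u a)^-1 * u b)%g \in (H / K :&: C)%g.
    rewrite inE groupM ?groupV ?uH //=.
    by have:= groupM Ca (groupVr Cb); rewrite invMg invgK mulgA mulgK.
  by rewrite tiHC => /set1P->.
pose f := [ffun g => odflt 0 [pick a | Q g a]].
have fE g a : Q g a -> f g = a.
  rewrite ffunE; case: pickP => [b Qb Qa|->//] /=; exact: Q_uniq Qb Qa.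
have fQ g : Q g (f g).
  have: coset K g \in ([set: gT] / K)%g by rewrite mem_quotient ?inE.
  rewrite -prodHC => /mulsgP[x c]; rewrite imu => /existsP[a /eqP ->] Cc def_g.
  have Qa : Q g a by rewrite /Q def_g mulKg.
  by rewrite (fE g a Qa).
have u0 : u 0 = 1%g by apply: (mulgI (u 0)); rewrite -uD addr0 mulg1.
exists f; split=> [|h Hh fh0|a].
- apply/vanishingP; split=> [|k Kk]; last first.
    by apply: fE; rewrite /Q u0 coset_id // invg1 mulg1 group1.
  apply/cocycle1P=> g h; apply: fE; rewrite /Q.
  have := groupM (fQ g) (fQ h); congr (_ \in C).
  rewrite addrC uD uG morphM ?inN // invMg -conjVg conjgE invgK !mulgA.
  by rewrite mulgKV.
- have:= fQ h; rewrite /Q fh0 u0 invg1 mul1g => Ch.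
  have: coset K h \in (H / K :&: C)%g by rewrite inE Ch mem_quotient.
  by rewrite tiHC => /set1P/coset_idr->.
have /morphimP[h _ Hh def_u] := uH a.
by exists h => //; apply: fE; rewrite /Q /= -def_u mulVg group1.
Qed.

(** The complement is the zero set of the cocycle, and the isomorphism sends
    [a] to the coset of any [h] in [H] with [f h = a]. *)
Lemma complement_of_splitting (K H : {group gT}) f :
    (K <| [set: gT])%g -> (H <| [set: gT])%g -> K \subset H ->
    acts_trivially H -> splitting_cocycle K H f ->
  [splits [set: gT] / K, over H / K]%g && gmod_isog tau H K.
Proof.
move=> nsKG nsHG sKH trivH [vKf kerf surjf].
have nKG := normal_norm nsKG.
have inN x : x \in 'N(K)%g by rewrite (subsetP nKG) ?inE.
have /vanishingP[Zf_ fK] := vKf; have Zf := cocycle1P _ Zf_.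
have trH := acts_triviallyP _ trivH.
have trivK : acts_trivially K.
  by apply/acts_triviallyP=> k Kk; apply/trH/(subsetP sKH).
have f1 := cocycle1_at1 Zf_.
have f_add h g : h \in H -> f (h * g)%g = f h + f g.
  by move=> Hh; rewrite Zf trH.
have f_inv h : h \in H -> f (h^-1)%g = - f h.
  by move=> Hh; apply: (addrI (f h)); rewrite -f_add // mulgV f1 subrr.
have f_coset h h' : h \in H -> h' \in H -> f h = f h' -> coset K h = coset K h'.
  move=> Hh Hh' eqf; apply/(rcoset_kercosetP (inN h) (inN h')).
  rewrite mem_rcoset.
  by apply: kerf; rewrite ?groupM ?groupV // f_add // f_inv // eqf subrr.
apply/andP; split.
  have gZ : group_set [set g | f g == 0].
    apply/group_setP; split=> [|g h]; rewrite !inE ?f1 //.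
    by move=> /eqP fg /eqP fh; rewrite Zf fg fh act0 addr0.
  apply/splitsP; exists (Group gZ / K)%G; apply/complP; split.
    apply/trivgP/subsetP=> x /setIP[/morphimP[h _ Hh ->]].
    case/morphimP=> z _ Zz eq_hz.
    rewrite inE /= coset_id //; apply: kerf => //.
    rewrite (vanishing_coset nsKG trivK vKf eq_hz); apply/eqP.
    by rewrite inE in Zz.
  have prodG : (H * Group gZ = [set: gT])%g; last first.
    by rewrite -quotientMl ?(subset_trans (subsetT H)) // prodG.
  apply/setP=> g; rewrite inE; apply/mulsgP.
  have [h Hh fh] := surjf (f g); exists h (h^-1 * g)%g; rewrite ?mulKVg // inE.
  by rewrite f_add ?groupV // f_inv // fh addNr.
pose sec a := odflt 1%g [pick h in H | f h == a].
have secP a : sec a \in H /\ f (sec a) = a.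
  rewrite /sec; case: pickP => [h /andP[Hh /eqP]|] //= nosec.
  by have [h Hh fh] := surjf a; have:= nosec h; rewrite Hh fh eqxx.
apply/existsP; exists [ffun a => coset K (sec a)]; apply/andP; split.
  apply/misomE; split=> [a b|a b|x].
  - rewrite !ffunE -morphM ?inN //; have [[Ha fa] [Hb fb]] := (secP a, secP b).
    have [Hab fab] := secP (a + b).
    by apply: f_coset; rewrite ?groupM // f_add // fa fb.
  - rewrite !ffunE => /(vanishing_coset nsKG trivK vKf).
    by rewrite !(proj2 (secP _)).
  apply/morphimP/existsP => [[h _ Hh ->] | [a /eqP ->]].
    have [Hs fs] := secP (f h).
    by exists (f h); rewrite ffunE; apply/eqP/f_coset.
  by exists (sec a); rewrite ?ffunE ?(proj1 (secP _)).
apply/forallP=> g; apply/forallP=> a; rewrite !ffunE; apply/eqP.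
have [[Ha fa] [Hga fga]] := (secP a, secP (tau g a)).
rewrite -morphV ?inN // -morphJ ?inN //.
have eqJ : (sec a ^ g^-1 = g * sec a * g^-1)%g by rewrite conjgE invgK mulgA.
rewrite eqJ; apply: f_coset; rewrite ?normal_conj //.
by rewrite (cocycle1_conj g nsHG) // fa.
Qed.

(** If some cocycle [f] that vanishes on [K] does not vanish on [H], then [f @:
    H] is a nonzero submodule, and the zeros of [f] in [H] form a normal
    subgroup that contains [K] and is proper in [H]. Simplicity of [E] and
    maximality of [K] make [f] a splitting cocycle. *)
Lemma chief_dichotomy (K H : {group gT}) :
    (H <| [set: gT])%g -> maxnormal K H [set: gT] -> acts_trivially H ->
  vanishing_cocycles K = vanishing_cocycles H
    \/ exists f, splitting_cocycle K H f.
Proof.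
move=> nsHG /maxgroupP[/andP[prKH nKG] maxK] trivH.
have sKH := proper_sub prKH.
have sHK : vanishing_cocycles H \subset vanishing_cocycles K.
  apply/subsetP=> f /vanishingP[Zf fH]; apply/vanishingP; split=> // h Kh.
  by apply/fH/(subsetP sKH).
case: (boolP (vanishing_cocycles K \subset vanishing_cocycles H)) => [sKH'|].
  by left; apply/eqP; rewrite eqEsubset sKH'.
case/subsetPn=> f vKf nvHf; right; exists f.
have /vanishingP[Zf_ fK] := vKf; have Zf := cocycle1P _ Zf_.
have trH := acts_triviallyP _ trivH.
have f1 := cocycle1_at1 Zf_.
have f_add h g : h \in H -> f (h * g)%g = f h + f g.
  by move=> Hh; rewrite Zf trH.
have gV : group_set (f @: H).
  apply/group_setP; split=> [|_ _ /imsetP[h Hh ->] /imsetP[h' Hh' ->]].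
    by apply/imsetP; exists 1%g; rewrite ?group1.
  by apply/imsetP; exists (h * h')%g; rewrite ?groupM // f_add.
have fHE : f @: H = [set: E].
  case: (@tau_simple (Group gV)) => [g _ /imsetP[h Hh ->] | V1 | //].
    apply/imsetP; exists (g * h * g^-1)%g; first exact: normal_conj.
    by rewrite (cocycle1_conj g nsHG).
  case/vanishingP: nvHf; split=> // h Hh.
  have: f h \in f @: H by apply: imset_f.
  by rewrite [f @: H]V1 => /set1P.
split=> // [|a]; last first.
  have: a \in f @: H by rewrite fHE inE.
  by case/imsetP=> h Hh ->; exists h.
have gZ : group_set [set h in H | f h == 0].
  apply/group_setP; split=> [|g h]; rewrite !inE ?f1 ?group1 ?eqxx //.
  move=> /andP[Hg /eqP fg] /andP[Hh /eqP fh].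
  by rewrite groupM ?f_add // fg fh addr0 eqxx.
have eqZ : [set h in H | f h == 0] = K.
  apply: (maxK (Group gZ)); last first.
    by apply/subsetP=> k Kk; rewrite inE (subsetP sKH) //= fK.
  apply/andP; split.
    apply/properP; split; first by apply/subsetP=> h; rewrite inE => /andP[].
    have [h Hh nfh] : exists2 h, h \in H & f h != 0.
      apply/exists_inP; apply: contraNT nvHf => /exists_inPn fH0.
      apply/vanishingP; split=> // h /fH0; rewrite negbK => /eqP //.
    by exists h; rewrite // inE Hh.
  apply/subsetP=> g _; rewrite inE; apply/subsetP.
  move=> _ /imsetP[h Zh ->].
  move: Zh; rewrite !inE. move=> /andP[Hh /eqP fh].
  have -> : (h ^ g = g^-1 * h * g^-1^-1)%g by rewrite conjgE invgK mulgA.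
  by rewrite normal_conj // (cocycle1_conj _ nsHG) // fh act0 eqxx.
by move=> h Hh fh; rewrite -eqZ inE Hh fh eqxx.
Qed.

(** * Counting cocycles along a chief series *)

Lemma acts_triviallyS (K H : {set gT}) :
  K \subset H -> acts_trivially H -> acts_trivially K.
Proof.
move=> sKH /acts_triviallyP trH; apply/acts_triviallyP=> k Kk.
exact/trH/(subsetP sKH).
Qed.

(** An abelian factor [H / K] is centralised by [H]. *)
Lemma gmod_isog_acts_trivially (K H : {group gT}) :
  abelian (H / K)%g -> gmod_isog tau H K -> acts_trivially H.
Proof.
move=> /centsP abHK /existsP[u /andP[/misomE[uD uI imu] uG]].
apply/acts_triviallyP=> h Hh a; apply: uI.
move/forallP: uG => /(_ h)/forallP/(_ a)/eqP->.
have ua : u a \in (H / K)%g by rewrite imu; apply/existsP; exists a.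
have HKh : ((coset K h)^-1)%g \in (H / K)%g by rewrite groupV mem_quotient.
by rewrite conjgE (abHK _ ua _ HKh) mulKg.
Qed.

Variable q : nat.
Hypotheses (q_pr : prime q) (qE : (q.-group [set: E])%g).
Hypothesis ntE : [set: E] != 1%g.

(** The contribution of coboundaries to the number of cocycles that vanish on
    [K]: a nonzero coboundary vanishes on [K] only if [K] acts trivially. *)
Definition coboundary_factor (K : {set gT}) :=
  (#|E| ^ (acts_trivially K && ~~ acts_trivially [set: gT]))%N.

Lemma coboundary_factor_gt0 K : (0 < coboundary_factor K)%N.
Proof. by rewrite expn_gt0; apply/orP; left; apply/card_gt0P; exists 0. Qed.

(** If [H / K] were a [q]-group it would have nonzero fixed points in [E], and
    [H] would act trivially. So averaging applies: a cocycle vanishing on [K]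
    differs by a coboundary from one vanishing on [H], and the latter is 0. *)
Lemma card_vanishing_unfaithful (K H : {group gT}) :
    (K <| [set: gT])%g -> (H <| [set: gT])%g -> is_abelem (H / K)%g ->
    acts_trivially K -> ~~ acts_trivially H ->
  #|vanishing_cocycles K| = #|E|.
Proof.
move=> nsKG nsHG /is_abelemP[p p_pr abHK] trK ntrH.
have ntrG : ~~ acts_trivially [set: gT].
  by apply: contra ntrH; apply: acts_triviallyS; apply: subsetT.
have co_EHK : coprime #|[set: E]| #|(H / K)%g|.
  have [p_q | p_q] := eqVneq p q.
    case/negP: ntrH; apply: (pgroup_acts_trivially ntE q_pr qE nsKG) => //.
    by rewrite -p_q; apply: abelem_pgroup abHK.
  apply: pnat_coprime qE _; apply: pi_pnat (abelem_pgroup abHK) _.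
  by rewrite inE.
have -> : vanishing_cocycles K = coboundaries1 tau.
  apply/setP=> f; apply/idP/imsetP => [vKf | [a _ ->]]; last first.
    apply/vanishingP; split=> [|k Kk]; first exact: coboundary_cocycle.
    by rewrite ffunE (acts_triviallyP _ trK) // subrr.
  have [a fa] := coprime_cocycle_coboundary nsKG trK co_EHK vKf.
  exists a => //; apply/eqP; rewrite -subr_eq0 -in_set1.
  rewrite -(vanishing_nontrivial nsHG ntrH); apply/vanishingP; split.
    by apply: cocycle1B; [case/vanishingP: vKf | apply: coboundary_cocycle].
  by move=> h Hh; rewrite 2!ffunE fa // subrr.
by rewrite card_coboundaries1 ntrG expn1.
Qed.

(** The quotient of the two coboundary factors is the order of [E] when [H] is
    the first term of the series that acts nontrivially, and 1 at every other
    step. *)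
Lemma card_vanishing_step (K H : {group gT}) :
    (K <| [set: gT])%g -> (H <| [set: gT])%g -> maxnormal K H [set: gT] ->
    is_abelem (H / K)%g ->
  (#|vanishing_cocycles K| * coboundary_factor H)%N
    = (#|gmod_End tau|
          ^ ([splits [set: gT] / K, over H / K]%g && gmod_isog tau H K)
        * #|vanishing_cocycles H| * coboundary_factor K)%N.
Proof.
move=> nsKG nsHG maxK abHK.
have /maxgroupP[/andP[/proper_sub sKH _] _] := maxK.
have abelHK : abelian (H / K)%g.
  by have /is_abelemP[p p_pr] := abHK; apply: abelem_abelian.
rewrite /coboundary_factor; case: (boolP (acts_trivially H)) => trH.
  have trK := acts_triviallyS sKH trH; rewrite trK; congr (_ * _)%N.
  case: (boolP (_ && _)) => [/andP[splHK isoHK] | not_counted].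
    have [f split_f] := splitting_of_complement nsKG splHK isoHK.
    by rewrite (card_vanishing_splitting nsHG sKH trH split_f) expn1 mulnC.
  have [-> | [f split_f]] := chief_dichotomy nsHG maxK trH.
    by rewrite mul1n.
  by case/negP: not_counted; apply: complement_of_splitting split_f.
have /negPf-> :
    ~~ ([splits [set: gT] / K, over H / K]%g && gmod_isog tau H K).
  by apply: contra trH => /andP[_]; apply: gmod_isog_acts_trivially.
rewrite (vanishing_nontrivial nsHG trH) cards1 expn0 muln1 !mul1n.
case: (boolP (acts_trivially K)) => trK.
  rewrite (card_vanishing_unfaithful nsKG nsHG abHK trK trH).
  suff ->: ~~ acts_trivially [set: gT] by rewrite expn1.
  by apply: contra trH; apply: acts_triviallyS; apply: subsetT.
by rewrite (vanishing_nontrivial nsKG trK) cards1 expn0.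
Qed.

Lemma card_vanishing_series (K : {group gT}) (cs : seq {group gT}) :
    solvable [set: gT] -> (K <| [set: gT])%g ->
    (([set: gT].-chief).-series K cs)%g -> last K cs = [set: gT]%G ->
  #|vanishing_cocycles K|
    = (#|gmod_End tau| ^ count (fun KH : {group gT} * {group gT} =>
           [splits [set: gT] / KH.1, over KH.2 / KH.1]%g
             && gmod_isog tau KH.2 KH.1) (zip (K :: cs) cs)
        * coboundary_factor K)%N.
Proof.
move=> solG; elim: cs K => [|H cs IHcs] K nsKG /=.
  move=> _ ->.
  rewrite mul1n /coboundary_factor andbN expn0 -(cards1 (0 : {ffun gT -> E})).
  congr #|pred_of_set _|; apply/setP=> f; rewrite in_set1.
  apply/vanishingP/eqP=> [[_ fG] | ->].
    by apply/ffunP=> g; rewrite fG ?inE // ffunE.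
  split=> [|h _]; last by rewrite ffunE.
  by apply/cocycle1P=> g h; rewrite !ffunE act0 addr0.
case/andP=> chiefHK ser lastH; have /andP[maxK nsHG] := chiefHK.
have abHK : is_abelem (H / K)%g.
  have solHK : solvable (H / K)%g.
    exact/quotient_sol/(solvableS (subsetT H) solG).
  have minHK := chief_factor_minnormal chiefHK.
  by case: (minnormal_solvable minHK (subxx _) solHK).
apply/eqP; rewrite -(eqn_pmul2r (coboundary_factor_gt0 H)).
rewrite card_vanishing_step // (IHcs H) // expnD !mulnA.
by apply/eqP; rewrite mulnAC.
Qed.

(** By [card_coboundaries1] the second factor is the order of B^1, so this says
    that |H^1| is |End|^alpha. *)
Theorem card_cocycles1_chief (cs : seq {group gT}) :
    solvable [set: gT] -> chief_series cs ->
  #|cocycles1 tau| = (#|gmod_End tau| ^ complemented_count tau cs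
                       * #|E| ^ ~~ acts_trivially [set: gT])%N.
Proof.
move=> solG /andP[ser /eqP lastG].
have := card_vanishing_series solG (normal1 _) ser lastG.
have tr1 : acts_trivially 1%g by apply/acts_triviallyP=> _ /set1P-> a.
by rewrite /coboundary_factor tr1 vanishing_at1.
Qed.

End Cocycles.

(** * Lifts of a homomorphism to the extension *)

Section Extension.

Variables (gT bT : finGroupType) (E : finZmodType).
Variables (i : {morphism [set: E] >-> gT}) (pi : {morphism [set: gT] >-> bT}).
Variables (s : bT -> gT) (sigma : bT -> {perm E}) (chi : {ffun bT * bT -> E}).
Hypothesis ext : extension i pi s sigma chi.

Lemma ext_iD a b : i (a + b) = (i a * i b)%g.
Proof. by rewrite -morphM ?inE. Qed.

Lemma ext_i0 : i 0 = 1%g.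
Proof. by apply: (mulgI (i 0)); rewrite -ext_iD addr0 mulg1. Qed.

Lemma ext_i_inj : injective i.
Proof. by move=> a b eq_i; apply: (injmP (ext_inj ext)); rewrite ?inE. Qed.

Lemma ext_piM : {morph pi : g h / (g * h)%g}.
Proof. by move=> g h; rewrite morphM ?inE. Qed.

Lemma ext_pi_i a : pi (i a) = 1%g.
Proof.
have: i a \in ('ker pi)%g by rewrite -(ext_exact ext) mem_morphim ?inE.
by move/mker.
Qed.

Lemma ext_coord_inj a b a' b' : 
  (i a * s b = i a' * s b')%g -> a = a' /\ b = b'.
Proof.
move=> eq_is; have eq_b : b = b'.
  have:= congr1 pi eq_is.
  by rewrite !ext_piM !ext_pi_i !mul1g !(ext_section ext).
by split=> //; move: eq_is; rewrite eq_b => /mulIg/ext_i_inj.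
Qed.

(** Every [x] of Gamma is uniquely [i a * s b]; then [b = pi x] and [a] is
    [coord x]. *)
Definition coord (x : gT) : E := odflt 0 [pick a | x == i a * s (pi x)]%g.

Lemma coordK x : (i (coord x) * s (pi x) = x)%g.
Proof.
rewrite /coord; case: pickP => [a /eqP <- //|no_a] /=.
have: (x * (s (pi x))^-1)%g \in ('ker pi)%g.
  apply/kerP; rewrite ?inE // ext_piM morphV ?inE //.
  by rewrite (ext_section ext) mulgV.
rewrite -(ext_exact ext) => /morphimP[a _ _ def_x].
by have:= no_a a; rewrite -def_x mulgKV eqxx.
Qed.

Lemma sigmaD b : {morph sigma b : x y / x + y}.
Proof.
by move=> x y; apply: (morphicP (Aut_morphic (ext_Aut ext b))); rewrite inE.
Qed.

(** [s (b * b')] and [s b * s b'] differ by an element of [i E], which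
    centralises [i E] because [E] is commutative. *)
Lemma sigmaM b b' a : sigma (b * b')%g a = sigma b (sigma b' a).
Proof.
have conjE := ext_conj ext; apply: ext_i_inj.
have sK := ext_section ext.
have := conjE (s b * s b')%g a; rewrite /pullback_act ext_piM !sK => ->.
by rewrite !(ext_sigma ext) invMg !mulgA.
Qed.

Lemma sigma1 a : sigma 1%g a = a.
Proof.
apply: ext_i_inj; rewrite (ext_sigma ext) (ext_section1 ext).
by rewrite mul1g invg1 mulg1.
Qed.

(** The source [dT] is Gamma for the lifts that are counted, and [B], with
    [rho] the identity, for the homomorphic sections of [pi]. *)
Section Lifts.

Variables (dT : finGroupType) (rho : dT -> bT).
Hypothesis rhoM : {morph rho : g h / (g * h)%g}.

Lemma pullback_actD g : {morph pullback_act sigma rho g : a b / a + b}.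
Proof. exact: sigmaD. Qed.

Lemma pullback_actM g h a :
  pullback_act sigma rho (g * h)%g a
    = pullback_act sigma rho g (pullback_act sigma rho h a).
Proof. by rewrite /pullback_act rhoM sigmaM. Qed.

Lemma morph_at1 : rho 1%g = 1%g.
Proof. by apply: (mulgI (rho 1%g)); rewrite -rhoM !mulg1. Qed.

Lemma pullback_act1 a : pullback_act sigma rho 1%g a = a.
Proof. by rewrite /pullback_act morph_at1 sigma1. Qed.

Definition lift_of (f : {ffun dT -> E}) (g : dT) : gT :=
  (i (f g) * s (rho g))%g.

Definition lifts : {set {ffun dT -> E}} :=
  [set f | delta1 (pullback_act sigma rho) f == - pullback_cocycle chi rho].

Lemma pi_lift f g : pi (lift_of f g) = rho g.
Proof. by rewrite ext_piM ext_pi_i mul1g (ext_section ext). Qed.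

Lemma lift_mul f g h :
  (lift_of f g * lift_of f h
    = i (f g + sigma (rho g) (f h) + chi (rho g, rho h)) * s (rho g * rho h))%g.
Proof.
rewrite !ext_iD (ext_sigma ext) (ext_chi ext) /lift_of.
by rewrite !mulgA !mulgKV.
Qed.

Lemma liftsP (f : {ffun dT -> E}) :
  reflect {morph lift_of f : g h / (g * h)%g} (f \in lifts).
Proof.
have E0 (x y z t : E) : (x - y + z == - t) = (y == z + x + t).
  by rewrite -addr_eq0 (addrAC x) (addrAC (x + z)) (addrC x) subr_eq0 eq_sym.
rewrite inE; apply: (iffP eqP) => [/ffunP lf g h | lfM].
  rewrite lift_mul /lift_of rhoM; congr (i _ * _)%g; apply/eqP.
  by have/eqP := lf (g, h); rewrite !ffunE /= E0.
apply/ffunP=> -[g h]; rewrite !ffunE /=; apply/eqP; rewrite E0; apply/eqP.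
by have:= lfM g h; rewrite lift_mul /lift_of rhoM => /ext_coord_inj[].
Qed.

Lemma card_lifts :
  #|lifts|
    = ([exists f, delta1 (pullback_act sigma rho) f
                    == - pullback_cocycle chi rho]
        * #|cocycles1 (pullback_act sigma rho)|)%N.
Proof. exact: (card_delta1_fiber pullback_actD). Qed.

End Lifts.

(** The sign in [c_chi] differs from that in [lifts]: sections correspond to
    the solutions of [delta1 f = - chi]. *)
Lemma card_lifts_id :
  #|lifts (@id bT)|
    = (c_chi sigma chi * #|cocycles1 (pullback_act sigma (@id bT))|)%N.
Proof.
rewrite card_lifts; congr (nat_of_bool _ * _)%N.
have -> : pullback_cocycle chi (@id bT) = chi.
  by apply/ffunP=> -[b b']; rewrite ffunE.
have dN := delta1N (pullback_actD (@id bT)).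
apply/existsP/imsetP => [[f /eqP df] | [f _ ->]].
  by exists (- f) => //; rewrite dN df opprK.
by exists (- f); rewrite dN.
Qed.

(** The identity of Gamma is the lift of [pi] with coordinate [coord]. *)
Lemma coord_lift : [ffun g => coord g] \in lifts pi.
Proof.
by apply/(liftsP ext_piM) => g h; rewrite /lift_of !ffunE !coordK.
Qed.

Lemma EpiP (rho : {ffun gT -> bT}) :
  reflect ({morph rho : g h / (g * h)%g} /\ forall b, exists g, rho g = b)
          (rho \in Epi gT bT).
Proof.
rewrite inE; apply: (iffP andP) => [[/morphicP rhoM /eqP surj] | [rhoM surj]].
  split=> [g h | b]; first by rewrite rhoM ?inE.
  have: b \in rho @: [set: gT] by rewrite surj inE.
  by case/imsetP=> g _ ->; exists g.
split; first by apply/morphicP=> g h _ _; apply: rhoM.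
apply/eqP/setP=> b; rewrite inE; apply/imsetP.
by have [g <-] := surj b; exists g.
Qed.

(** An automorphism [u] is determined by its two coordinates: the epimorphism
    [pi u] and the solution [coord u]. *)
Lemma card_Aut_lifts :
  #|Aut [set: gT]|
    = (\sum_(rho in Epi gT bT)
         #|[set f in lifts rho | injectiveb (lift_of rho f)]|)%N.
Proof.
pose coords (u : {perm gT}) := ([ffun g => pi (u g)], [ffun g => coord (u g)]).
have coords_inj : injective coords.
  move=> u v [/ffunP eq_pi /ffunP eq_co]; apply/permP=> g.
  move: (eq_pi g) (eq_co g); rewrite !ffunE => eq_pig eq_cog.
  by rewrite -[u g]coordK -[v g]coordK eq_pig eq_cog.
rewrite -(card_imset _ coords_inj).
under eq_bigr do rewrite -sum1_card.
rewrite pair_big_dep /= sum1dep_card; congr #|pred_of_set _|.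
apply/setP=> -[rho f]; rewrite inE /=.
apply/imsetP/andP=> [[u Au [-> ->]] | [/EpiP[rhoM _]]].
  have uM : {morph u : g h / (g * h)%g}.
    by move=> g h; apply: (morphicP (Aut_morphic Au)); rewrite inE.
  have rhoM : {morph [ffun g => pi (u g)] : g h / (g * h)%g}.
    by move=> g h; rewrite !ffunE uM ext_piM.
  have liftE : lift_of [ffun g => pi (u g)] [ffun g => coord (u g)] =1 u.
    by move=> g; rewrite /lift_of !ffunE coordK.
  split.
    apply/EpiP; split=> // b; exists (u^-1 (s b))%g.
    by rewrite ffunE permKV (ext_section ext).
  apply/setIdP; split.
    by apply/(liftsP rhoM)=> g h; rewrite !liftE uM.
  by apply/injectiveP=> g h; rewrite !liftE; apply: perm_inj.
case/setIdP=> lf /injectiveP inj_f; exists (perm inj_f).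
  rewrite inE; apply/andP; split; first by apply/subsetP=> g _; rewrite inE.
  by apply/morphicP=> g h _ _; rewrite !permE; apply: (liftsP rhoM).
congr (_, _); apply/ffunP=> g; rewrite !ffunE permE; first by rewrite pi_lift.
by have /ext_coord_inj[] := coordK (lift_of rho f g).
Qed.

(** Inflation along [pi] is the bijection. *)
Lemma card_vanishing_inflation :
  #|vanishing_cocycles (pullback_act sigma pi) (i @* [set: E])%g|
    = #|cocycles1 (pullback_act sigma id)|.
Proof.
pose inf (f : {ffun bT -> E}) := [ffun g => f (pi g)].
have inf_inj : injective inf.
  move=> f f' /ffunP eq_f; apply/ffunP=> b.
  by have:= eq_f (s b); rewrite !ffunE (ext_section ext).
rewrite -(card_imset _ inf_inj); congr #|pred_of_set _|; apply/setP=> f.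
apply/vanishingP/imsetP=> [[/cocycle1P Zf fE] | [fB ZfB ->]]; last first.
  have Zinf : inf fB \in cocycles1 (pullback_act sigma pi).
    by apply/cocycle1P=> g h; rewrite !ffunE ext_piM (cocycle1P _ _ ZfB).
  split=> // _ /morphimP[a _ _ ->]; rewrite ffunE ext_pi_i.
  exact: (cocycle1_at1 (pullback_act1 _) ZfB).
have fiE a : f (i a) = 0 by apply: fE; rewrite mem_morphim ?inE.
have f_s g : f g = f (s (pi g)).
  by rewrite -{1}(coordK g) Zf fiE add0r /pullback_act ext_pi_i sigma1.
exists [ffun b => f (s b)]; last by apply/ffunP=> g; rewrite !ffunE f_s.
apply/cocycle1P=> b b'; rewrite !ffunE.
have piss : pi (s b * s b')%g = (b * b')%g.
  by rewrite ext_piM !(ext_section ext).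
by rewrite -piss -f_s Zf /pullback_act (ext_section ext).
Qed.

(** For a section given by [fB], the difference of the lifts [coord] and [fB \o
    pi] of [pi] is a cocycle whose restriction to [i E] is inverse to [i]; so
    it splits the bottom factor [i E]. *)
Lemma card_cocycles1_split : lifts (@id bT) != set0 ->
  #|cocycles1 (pullback_act sigma pi)|
    = (#|cocycles1 (pullback_act sigma (@id bT))|
        * #|gmod_End (pullback_act sigma pi)|)%N.
Proof.
case/set0Pn=> fB lfB; rewrite -card_vanishing_inflation.
have idM : {morph @id bT : b b' / (b * b')%g} by [].
have piM := ext_piM.
have nsiE : (i @* [set: E] <| [set: gT])%g.
  by rewrite (ext_exact ext) ker_normal.
have tr_iE : acts_trivially (pullback_act sigma pi) (i @* [set: E])%g.
  apply/acts_triviallyP=> _ /morphimP[a _ _ ->] b.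
  by rewrite /pullback_act ext_pi_i sigma1.
pose f0 := [ffun g => coord g] - [ffun g => fB (pi g)].
have Zf0 : f0 \in cocycles1 (pullback_act sigma pi).
  have lfpi : [ffun g => fB (pi g)] \in lifts pi.
    apply/(liftsP piM)=> g h; rewrite /lift_of !ffunE.
    by have := liftsP idM _ lfB (pi g) (pi h); rewrite /lift_of piM.
  have := coord_lift; move: lfpi; rewrite !inE => /eqP d1 /eqP d2.
  rewrite -(inj_eq (addIr (- pullback_cocycle chi pi))) add0r -{1}d1.
  by rewrite -(delta1D (pullback_actD _)) subrK d2.
have fB1 : fB 1%g = 0.
  have := liftsP idM _ lfB 1%g 1%g; rewrite mulg1 => /esym/(canRL (mulgK _)).
  rewrite mulgV /lift_of (ext_section1 ext) mulg1 => fB1.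
  by apply: ext_i_inj; rewrite fB1 ext_i0.
have f0i a : f0 (i a) = a.
  rewrite !ffunE ext_pi_i fB1 subr0.
  have := coordK (i a); rewrite ext_pi_i -[RHS]mulg1 -(ext_section1 ext).
  by case/ext_coord_inj.
have van1 := vanishing_at1 (pullback_act1 piM).
rewrite -van1.
apply: (card_vanishing_splitting (pullback_actD _) nsiE (sub1G _) tr_iE
         (f0 := f0)).
split; first by rewrite van1.
  move=> _ /morphimP[a _ _ ->]; rewrite f0i => ->.
  by apply/set1P; apply: ext_i0.
by move=> a; exists (i a); rewrite ?mem_morphim ?inE.
Qed.

(** * Non-injective lifts *)

Hypothesis minE : minnormal (i @* [set: E]) [set: gT].

Lemma minnormal_ntE : [set: E] != 1%g.
Proof.
have /mingroupP[/andP[ntiE _] _] := minE.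
apply: contraNneq ntiE => E1; rewrite -subG1; apply/subsetP.
move=> _ /morphimP[a _ _ ->]; have: a \in [set: E] by rewrite inE.
by rewrite E1 => /set1P->; rewrite ext_i0 group1.
Qed.

Lemma pullback_simple (dT : finGroupType) (rho : dT -> bT) :
  (forall b, exists g, rho g = b) -> gmod_simple (pullback_act sigma rho).
Proof.
move=> rho_surj V stabV; have /mingroupP[_ miniE] := minE.
have [/eqP V1 | ntV] := boolP (V :==: 1%g); [by left | right].
have iVE : (i @* V = i @* [set: E])%g.
  apply: (miniE (i @* V)%G); last by rewrite morphimS ?subsetT.
  apply/andP; split; first by rewrite morphim_injm_eq1 ?(ext_inj ext) ?subsetT.
  apply/subsetP=> g _; rewrite inE; apply/subsetP.
  move=> _ /imsetP[_ /morphimP[a _ Va ->] ->].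
  have [h def_h] := rho_surj (pi g^-1)%g.
  have <- : i (pullback_act sigma rho h a) = (i a ^ g)%g.
    by rewrite /pullback_act def_h (ext_conj ext) invgK conjgE mulgA.
  by rewrite mem_morphim ?inE // stabV.
by apply: (injm_morphim_inj (ext_inj ext)); rewrite ?subsetT.
Qed.

(** The [a] with [i a] in the image of the lift form a submodule [V], because
    conjugating [i a] by [phi x] applies [sigma (rho x)] to [a]. If [V] is [E],
    the image contains [i E] and maps onto [B], so [phi] is onto, hence
    injective. If [V] is 0, then [rho g = rho h] forces [phi g = phi h], since
    these differ by an element of [i E]. *)
Lemma noninjective_lift_factors (rho : {ffun gT -> bT}) f :
    rho \in Epi gT bT -> f \in lifts rho ->
    ~~ injectiveb (lift_of rho f) ->
  forall g h, rho g = rho h -> f g = f h.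
Proof.
case/EpiP=> rhoM rho_surj lf ninj g h eq_rho; have fM := liftsP rhoM _ lf.
set phi := lift_of rho f in fM ninj.
have phi1 : phi 1%g = 1%g by apply: (mulgI (phi 1%g)); rewrite -fM !mulg1.
have phiV x : phi (x^-1)%g = ((phi x)^-1)%g.
  by apply: (mulgI (phi x)); rewrite -fM !mulgV phi1.
pose V := [set a | [exists x, i a == phi x]].
have VP a : reflect (exists x, i a = phi x) (a \in V).
  rewrite inE; apply: (iffP existsP) => [[x /eqP ax] | [x ax]];
    by exists x; rewrite ?ax.
have gV : group_set V.
  apply/group_setP; split=> [|a b /VP[x ia] /VP[y ib]]; apply/VP.
    by exists 1%g; rewrite phi1 ext_i0.
  by exists (x * y)%g; rewrite ext_iD ia ib fM.
case: (@pullback_simple _ _ rho_surj (Group gV)) => [x a /VP[y ia] | V1 | VE].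
- apply/VP; exists (x * y * x^-1)%g; rewrite !fM phiV -ia /phi /lift_of.
  rewrite (_ : (_ * _)%g =
    i (f x) * (s (rho x) * i a * (s (rho x))^-1) * (i (f x))^-1)%g.
    by rewrite -(ext_sigma ext) -ext_iD addrC ext_iD mulgK.
  by rewrite invMg !mulgA.
- have : f g - f h \in V.
    apply/VP; exists (g * h^-1)%g; rewrite fM phiV /phi /lift_of eq_rho invMg.
    apply: (mulIg (i (f h))); rewrite -ext_iD subrK.
    by rewrite !mulgA mulgK mulgKV.
  by rewrite [V]V1 => /set1P/eqP; rewrite subr_eq0 => /eqP.
(* Here V = E; surjectivity makes phi injective because gT is finite. *)
suff /image_injP inj_phi : #|image phi gT| == #|gT|.
  by case/negP: ninj; apply/injectiveP=> x y; apply: inj_phi.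
apply/eqP/eq_card=> x; rewrite [RHS]inE; apply/imageP.
have [y rho_y] := rho_surj (pi x).
have /VP[z iz] : coord x - f y \in V by rewrite [V]VE inE.
exists (z * y)%g => //; rewrite fM -iz /phi /lift_of rho_y mulgA -ext_iD subrK.
by rewrite coordK.
Qed.

(** By [noninjective_lift_factors] such a lift is a section composed with
    [rho]. Conversely, such a composite has image a complement of [i E], so it
    is neither onto nor injective. *)
Lemma card_noninjective_lifts (rho : {ffun gT -> bT}) :
    rho \in Epi gT bT ->
  #|[set f in lifts rho | ~~ injectiveb (lift_of rho f)]|
    = #|lifts (@id bT)|.
Proof.
move=> rho_epi; have [rhoM rho_surj] := EpiP _ rho_epi.
have idM : {morph @id bT : b b' / (b * b')%g} by [].
pose inf (f : {ffun bT -> E}) := [ffun g => f (rho g)].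
have inf_inj : injective inf.
  move=> f f' /ffunP eq_f; apply/ffunP=> b; have [g <-] := rho_surj b.
  by have:= eq_f g; rewrite !ffunE.
have infE fB g : lift_of rho (inf fB) g = lift_of id fB (rho g).
  by rewrite /lift_of ffunE.
rewrite -(card_imset (lifts id) inf_inj).
congr #|pred_of_set _|; apply/setP=> f.
apply/setIdP/imsetP=> [[lf ninj] | [fB lfB ->]]; last first.
  have fM := liftsP idM _ lfB; split.
    by apply/(liftsP rhoM)=> g h; rewrite !infE rhoM fM.
  (* An injective lift is onto, so i a is a value t (rho g) of the section; then
     rho g = pi (i a) = 1, and i a = t 1 = 1. *)
  apply/negP=> /injectiveP inj; case/negP: minnormal_ntE; apply/eqP/trivgP.
  apply/subsetP=> a _; apply/set1P; apply: ext_i_inj; rewrite ext_i0.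
  have [psi _ psiK] := injF_bij inj; have := psiK (i a).
  move=> /[dup]/(congr1 pi); rewrite pi_lift ext_pi_i infE => -> <-.
  by apply: (mulgI (lift_of id fB 1%g)); rewrite -fM !mulg1.
pose sec b := odflt 1%g [pick g | rho g == b].
have secK b : rho (sec b) = b.
  rewrite /sec; case: pickP => [g /eqP //|no_g] /=.
  by have [g rho_g] := rho_surj b; have:= no_g g; rewrite rho_g eqxx.
have f_sec g : f (sec (rho g)) = f g.
  by apply: (noninjective_lift_factors rho_epi lf ninj); rewrite secK.
pose fB := [ffun b => f (sec b)].
have def_f : f = inf fB by apply/ffunP=> g; rewrite !ffunE f_sec.
have phiE g : lift_of rho f g = lift_of id fB (rho g) by rewrite {1}def_f infE.
exists fB => //; apply/(liftsP idM)=> b b'.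
by rewrite -[b]secK -[b']secK -rhoM -!phiE (liftsP rhoM _ lf).
Qed.

End Extension.

(** * The number of automorphisms *)

Lemma card_Zq_dim (q : nat) (aT : finGroupType) (V : {group aT}) :
  (q.-abelem V)%g -> #|V| = (q ^ Zq_dim V)%N.
Proof.
move=> abV; rewrite /Zq_dim (grank_abelian (abelem_abelian abV)).
by rewrite (rank_abelem abV) -(card_pgroup (abelem_pgroup abV)).
Qed.

Lemma card_cocycles1_H1 (q : nat) (gT : finGroupType) (E : finZmodType)
    (tau : gT -> E -> E) :
    (forall g, {morph tau g : a b / a + b}) ->
    (forall g h a, tau (g * h)%g a = tau g (tau h a)) ->
    prime q -> (q.-abelem [set: E])%g ->
  #|cocycles1 tau| = (q ^ Zq_dim (H1 tau) * #|coboundaries1 tau|)%N.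
Proof.
move=> tauD tauM q_pr abE.
pose Z := Group (cocycles1_group_set tauD).
pose B := Group (coboundaries1_group_set tauD).
have sBZ : B \subset Z := sub_coboundaries1 tauD tauM.
have nBZ : (Z \subset 'N(B))%g.
  apply: subset_trans (subsetT _) (sub_abelian_norm _ (subsetT _)).
  exact: FinRing.zmod_abelian.
have abH : (q.-abelem (Z / B))%g := H1_abelem tauD q_pr abE.
have := card_Zq_dim abH; rewrite -/(H1 tau) => <-.
by rewrite card_quotient // mulnC -[RHS]/(#|B| * _)%N (Lagrange sBZ).
Qed.

Theorem corollary4p6 (q : nat) (gT bT : finGroupType) (E : finZmodType)
    (i : {morphism [set: E] >-> gT}) (pi : {morphism [set: gT] >-> bT})
    (s : bT -> gT) (sigma : bT -> {perm E}) (chi : {ffun bT * bT -> E})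
    (cs : seq {group gT}) (kappa : nat) :
  prime q ->
  solvable [set: bT] ->
  (q.-abelem [set: E])%g ->
  extension i pi s sigma chi ->
  minnormal (i @* [set: E]) [set: gT] ->
  chief_series cs ->
  (q ^ kappa)%N = #|gmod_End (pullback_act sigma pi)| ->
  #|Aut [set: gT]|%:R =
    #|E|%:R ^+ zeta sigma *
    \sum_(rho in Epi gT bT)
      ((epsilon sigma chi rho)%:R
         * q%:R ^+ Zq_dim (H1 (pullback_act sigma rho))
       - (c_chi sigma chi)%:R
           * q%:R ^ (kappa%:Z * ((alpha pi sigma cs)%:Z - 1))) :> rat.
Proof.
move=> q_pr solB abE ext minE chief_cs kappaE.
have ntE := minnormal_ntE minE.
have q_neq0 : (q%:R : rat) != 0 by rewrite pnatr_eq0 -lt0n prime_gt0.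
have pi_surj b : exists g, pi g = b by exists (s b); apply: (ext_section ext).
have triv_zeta (dT : finGroupType) (rho : dT -> bT) :
    (forall b, exists g, rho g = b) ->
  ~~ acts_trivially (pullback_act sigma rho) [set: dT] = zeta sigma :> nat.
  move=> rho_surj; congr (nat_of_bool (~~ _)).
  apply/acts_triviallyP/forallP => [tr b | tr g _ a].
    by apply/forallP=> a; have [g <-] := rho_surj b; apply/eqP/tr; rewrite inE.
  by apply/eqP; move/forallP: (tr (rho g)) => /(_ a).
have solG : solvable [set: gT].
  have solK : solvable ('ker pi)%g.
    rewrite -(ext_exact ext); apply: morphim_sol.
    exact/abelian_sol/(abelem_abelian abE).
  rewrite (series_sol (ker_normal pi)) solK /=.
  by rewrite (isog_sol (first_isog pi)) /= (ext_surj ext).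
have noninjE : #|lifts sigma chi (@id bT)|%:R
    = #|E|%:R ^+ zeta sigma * ((c_chi sigma chi)%:R
        * q%:R ^ (kappa%:Z * ((alpha pi sigma cs)%:Z - 1))) :> rat.
  have := card_lifts_id ext; rewrite /c_chi.
  case: (boolP (chi \in _)) => [_ | _ ->]; last first.
    by rewrite !mul0n mul0r mulr0.
  rewrite !mul1n !mul1r => liftsB.
  have split_ext : lifts sigma chi (@id bT) != set0.
    rewrite -card_gt0 liftsB; apply/card_gt0P; exists 0.
    exact: (group1 (Group (cocycles1_group_set (pullback_actD ext (@id bT))))).
  (* Comparing the two counts of Z^1(Gamma, E) gives
     |Z^1(B, E)| q^kappa = q^(kappa alpha) |E|^zeta. *)
  have := card_cocycles1_split ext split_ext.
  rewrite (card_cocycles1_chief (pullback_actD ext pi)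
    (pullback_actM ext (ext_piM pi)) (pullback_act1 ext (ext_piM pi))
    (pullback_simple ext minE pi_surj) q_pr (abelem_pgroup abE) ntE solG
    chief_cs).
  rewrite triv_zeta // -kappaE -liftsB -expnM.
  move/(congr1 (GRing.natmul (1 : rat))).
  rewrite !natrM !natrX => eq_count.
  have qk_neq0 : (q%:R ^+ kappa : rat) != 0 by rewrite expf_neq0.
  apply: (mulIf qk_neq0); rewrite -eq_count -mulrA [RHS]mulrC; congr (_ * _).
  rewrite !exprnP -expfzDr //; congr (_ ^ _).
  by rewrite mulrBr mulr1 subrK PoszM.
rewrite (card_Aut_lifts ext) natr_sum mulr_sumr; apply: eq_bigr => rho rho_epi.
have [rhoM rho_surj] := EpiP _ rho_epi.
rewrite mulrBr -noninjE -(card_noninjective_lifts ext minE rho_epi).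
apply/eqP; rewrite eq_sym subr_eq -natrD; apply/eqP.
have -> : (#|[set f in lifts sigma chi rho | injectiveb (lift_of i s rho f)]|
     + #|[set f in lifts sigma chi rho | ~~ injectiveb (lift_of i s rho f)]|)%N
   = #|lifts sigma chi rho|.
  rewrite -(cardsID [set f | injectiveb (lift_of i s rho f)]
                    (lifts sigma chi rho)); congr (_ + _)%N.
    by apply: eq_card => f; rewrite !inE.
  by apply: eq_card => f; rewrite !inE andbC.
have [actD actM] := (pullback_actD ext rho, pullback_actM ext rhoM).
rewrite (card_lifts ext) (card_cocycles1_H1 actD actM q_pr abE).
rewrite (card_coboundaries1 actD actM); last first.
  exact: (pullback_simple ext minE rho_surj).
by rewrite triv_zeta // !natrM !natrX mulrA mulrC.
Qed.
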